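(* For every code $\nu:\mathrm E$, the underlying type of $\Delta\nu$ is a retract of $\mathbb N$, hence discrete, and moreover the ordinal $\Delta\nu$ is trichotomous.
   Context: Foundation: intensional Martin-Löf type theory as in the HoTT Book, with $\mathbf 0$, $\mathbf 1$ (point $\star$), $\mathbf 2$, $\mathbb N$, $+$, $\Pi$, $\Sigma$, universes, univalence (hence function extensionality), propositional truncation, set quotients, and inductive-recursive definitions. No excluded middle is assumed. A type is discrete if it has decidable equality. $Y$ is a retract of $X$ if there are $r:X\to Y$, $s:Y\to X$ with $r\circ s$ the identity. Ordinals. An ordinal is a type with a proposition-valued, transitive, extensional (elements with the same predecessors are equal), well-founded relation $<$; the same symbol denotes an ordinal and its underlying type. It is trichotomous if for all $x,y$ we have $x<y$ or $x=y$ or $y<x$. $\mathbf 1$ is an ordinal with the empty order. A topped ordinal is an ordinal with a specified point $t$ such that $\neg(t<y)$ for all $y$; $\mathrm{Ord}^\top$ is their type. For a topped ordinal $\tau$ and $\upsilon:\tau\to\mathrm{Ord}^\top$, $\Sigma_\tau\upsilon$ is the topped ordinal $\Sigma_{x:\tau}\upsilon\,x$ with the lexicographic order: $(x,a)<(x',a')$ iff $x<x'$, or there is $r:x=x'$ such that the transport of $a$ along $r$ is below $a'$; its top is the pair of the top of $\tau$ with the top of the fiber over it. The sum $\tau+\upsilon$ of topped ordinals is the lexicographic sum, over the two-point topped ordinal with underlying type $\mathbf 1+\mathbf 1$ and $\mathrm{inl}\,\star<\mathrm{inr}\,\star$, of the family with members $\tau,\upsilon$. The topped ordinal $\omega+\mathbf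 1$ is $\mathbb N+\mathbf 1$ with the usual order on $\mathbb N$ and the added point as top, above all $\mathrm{inl}\,n$. Codes. The type $\mathrm E$ and the function $\Delta:\mathrm E\to\mathrm{Ord}^\top$ are defined simultaneously by induction-recursion. Constructors of $\mathrm E$: $\ulcorner\mathbf 1\urcorner:\mathrm E$; $\ulcorner\omega+\mathbf 1\urcorner:\mathrm E$; $\nu_0\,\ulcorner+\urcorner\,\nu_1$ and $\nu_0\,\ulcorner\times\urcorner\,\nu_1$ for $\nu_0,\nu_1:\mathrm E$; $\ulcorner\Sigma\urcorner\,\nu\,A$ for $\nu:\mathrm E$ and $A:\Delta\nu\to\mathrm E$. Recursion: $\Delta\ulcorner\mathbf 1\urcorner=\mathbf 1$; $\Delta\ulcorner\omega+\mathbf 1\urcorner=\omega+\mathbf 1$; $\Delta(\nu_0\,\ulcorner+\urcorner\,\nu_1)=\Delta\nu_0+\Delta\nu_1$; $\Delta(\nu_0\,\ulcorner\times\urcorner\,\nu_1)=\Sigma_{\Delta\nu_0}(\lambda\_.\,\Delta\nu_1)$; $\Delta(\ulcorner\Sigma\urcorner\,\nu\,A)=\Sigma_{\Delta\nu}(\Delta\circ A)$. *)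

(* Defs.v *)
From Stdlib Require Import FunctionalExtensionality PeanoNat Peano_dec Wf_nat.

Set Implicit Arguments.
Unset Strict Implicit.

(* Equality types are the Rocq [=], and the order relation takes values in
   [Prop].  Being a proposition in the homotopy sense (any two proofs are
   equal) is the field [olt_irrelevant], so that proof irrelevance of [Prop]
   is not assumed as an axiom; function extensionality is the only axiom used
   here. *)

Record ordinal : Type := Ordinal {
  osort :> Type;
  olt : osort -> osort -> Prop;
  olt_irrelevant : forall (x y : osort) (p q : olt x y), p = q;
  olt_trans : forall x y z : osort, olt x y -> olt y z -> olt x z;
  olt_ext : forall x y : osort, (forall u, olt u x <-> olt u y) -> x = y;
  olt_wf : well_founded olt
}.

Arguments olt {o} x y.
Notation "x ≺ y" := (olt x y) (at level 70, no associativity).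

Record topped_ordinal : Type := ToppedOrdinal {
  tord :> ordinal;
  top : tord;
  top_max : forall y : tord, ~ (top ≺ y)
}.

Arguments top {t}.

Lemma olt_irrefl (o : ordinal) (x : o) : ~ (x ≺ x).
Proof.
induction (olt_wf x) as [x _ IH]; intro h; exact (IH x h h).
Qed.

(* The carrier of an ordinal is a set: extensionality gives a constant
   endomap of each identity type (Hedberg's argument). *)
Lemma ordinal_uip (o : ordinal) (x y : o) (p q : x = y) : p = q.
Proof.
assert (irr : forall (a b : o) (f g : forall u : o, u ≺ a <-> u ≺ b), f = g).
{ intros a b f g; apply functional_extensionality_dep; intro u.
  destruct (f u) as [f1 f2], (g u) as [g1 g2].
  f_equal; apply functional_extensionality; intro; apply olt_irrelevant. }
pose (same := fun (a b : o) (e : a = b) (u : o) =>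
  match e in _ = b return u ≺ a <-> u ≺ b with eq_refl => iff_refl _ end).
pose (k := fun (a b : o) (e : a = b) => olt_ext (same a b e)).
assert (can : forall (b : o) (e : x = b),
          e = eq_trans (eq_sym (k x x eq_refl)) (k x b e)).
{ intros b e; destruct e; symmetry; apply eq_trans_sym_inv_l. }
rewrite (can y p), (can y q); f_equal; unfold k; f_equal; apply irr.
Qed.

Section LexicographicSum.

Variables (tau : topped_ordinal) (upsilon : tau -> topped_ordinal).

Definition sum_sort : Type := {x : tau & upsilon x}.

Definition sum_lt (u v : sum_sort) : Prop :=
  projT1 u ≺ projT1 v \/
  exists r : projT1 u = projT1 v,
    eq_rect (projT1 u) (fun x => upsilon x) (projT2 u) (projT1 v) r ≺ projT2 v.

Lemma sum_lt_irrelevant (u v : sum_sort) (p q : sum_lt u v) : p = q.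
Proof.
assert (excl : projT1 u ≺ projT1 v -> projT1 u = projT1 v -> False).
{ intros h r; rewrite r in h; exact (olt_irrefl h). }
destruct p as [p | [r p]], q as [q | [s q]].
- f_equal; apply olt_irrelevant.
- destruct (excl p s).
- destruct (excl q r).
- destruct (ordinal_uip r s); f_equal; f_equal; apply olt_irrelevant.
Qed.

Lemma sum_lt_trans (u v w : sum_sort) : sum_lt u v -> sum_lt v w -> sum_lt u w.
Proof.
destruct u as [x a], v as [y b], w as [z c]; unfold sum_lt; simpl.
intros [p | [r p]] [q | [s q]].
- left; exact (olt_trans p q).
- left; destruct s; exact p.
- left; destruct r; exact q.
- right; destruct r, s; exists eq_refl; exact (olt_trans p q).
Qed.

(* Extensionality uses the tops of the fibres. *)
Lemma sum_lt_ext (u v : sum_sort) :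
  (forall w, sum_lt w u <-> sum_lt w v) -> u = v.
Proof.
assert (fst_lt : forall u v : sum_sort, (forall w, sum_lt w u -> sum_lt w v) ->
          forall z, z ≺ projT1 u -> z ≺ projT1 v).
{ intros u' v' h z hz.
  destruct (h (existT _ z top) (or_introl hz)) as [hz' | [r hr]];
    [exact hz' | exfalso].
  simpl in r, hr; destruct v' as [y b]; simpl in *; destruct r.
  exact (top_max hr). }
assert (snd_lt : forall x (a b : upsilon x),
          (forall w, sum_lt w (existT _ x a) -> sum_lt w (existT _ x b)) ->
          forall c, c ≺ a -> c ≺ b).
{ intros x a b h c hc.
  destruct (h (existT _ x c) (or_intror (ex_intro _ eq_refl hc)))
    as [hx | [r hr]].
  - destruct (olt_irrefl hx).
  - simpl in r, hr; rewrite (ordinal_uip r eq_refl) in hr; exact hr. }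
intro h; assert (e : projT1 u = projT1 v).
{ apply olt_ext; intro z; split; apply fst_lt; intro w; apply h. }
destruct u as [x a], v as [y b]; simpl in e; destruct e; f_equal.
apply olt_ext; intro c; split; apply snd_lt; intro w; apply h.
Qed.

Lemma sum_lt_wf : well_founded sum_lt.
Proof.
intros [x a]; revert a; induction (olt_wf x) as [x _ IHx]; intro a.
induction (olt_wf a) as [a _ IHa]; constructor.
intros [y b] [h | [r h]]; simpl in *.
- exact (IHx y h b).
- destruct r; exact (IHa b h).
Qed.

Definition sum_top : sum_sort := existT _ top top.

Lemma sum_top_max (u : sum_sort) : ~ sum_lt sum_top u.
Proof.
destruct u as [y b]; intros [h | [r h]]; simpl in *.
- exact (top_max h).
- destruct r; exact (top_max h).
Qed.

Definition ordinal_sum : topped_ordinal :=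
  @ToppedOrdinal
    (Ordinal sum_lt_irrelevant sum_lt_trans sum_lt_ext sum_lt_wf)
    sum_top sum_top_max.

End LexicographicSum.

Arguments ordinal_sum tau upsilon : clear implicits.

Definition one_lt (x y : unit) : Prop := False.

Lemma one_lt_irrelevant (x y : unit) (p q : one_lt x y) : p = q.
Proof. destruct p. Qed.

Lemma one_lt_trans (x y z : unit) : one_lt x y -> one_lt y z -> one_lt x z.
Proof. intros []. Qed.

Lemma one_lt_ext (x y : unit) : (forall u, one_lt u x <-> one_lt u y) -> x = y.
Proof. destruct x, y; reflexivity. Qed.

Lemma one_lt_wf : well_founded one_lt.
Proof. intro x; constructor; intros y []. Qed.

Lemma one_top_max (y : unit) : ~ one_lt tt y.
Proof. intros []. Qed.

Definition ordinal_one : topped_ordinal :=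
  @ToppedOrdinal
    (Ordinal one_lt_irrelevant one_lt_trans one_lt_ext one_lt_wf)
    tt one_top_max.

Definition two_lt (x y : unit + unit) : Prop :=
  match x, y with
  | inl _, inr _ => True
  | _, _ => False
  end.

Lemma two_lt_irrelevant (x y : unit + unit) (p q : two_lt x y) : p = q.
Proof.
destruct x, y; simpl in p, q; try contradiction; destruct p, q; reflexivity.
Qed.

Lemma two_lt_trans (x y z : unit + unit) :
  two_lt x y -> two_lt y z -> two_lt x z.
Proof. destruct x, y, z; simpl; tauto. Qed.

Lemma two_lt_ext (x y : unit + unit) :
  (forall u, two_lt u x <-> two_lt u y) -> x = y.
Proof.
destruct x as [[] | []], y as [[] | []]; intro h; try reflexivity;
  destruct (h (inl tt)) as [h1 h2]; simpl in *; tauto.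
Qed.

Lemma two_lt_wf : well_founded two_lt.
Proof.
assert (h : forall x, Acc two_lt (inl x))
  by (intro x; constructor; intros [y | y] []).
intros [x | x]; [exact (h x) | constructor].
intros [y | y] hy; [exact (h y) | destruct hy].
Qed.

Lemma two_top_max (y : unit + unit) : ~ two_lt (inr tt) y.
Proof. destruct y; intros []. Qed.

Definition ordinal_two : topped_ordinal :=
  @ToppedOrdinal
    (Ordinal two_lt_irrelevant two_lt_trans two_lt_ext two_lt_wf)
    (inr tt) two_top_max.

Definition omega_one_lt (x y : nat + unit) : Prop :=
  match x, y with
  | inl m, inl n => m < n
  | inl _, inr _ => True
  | inr _, _ => False
  end.

Lemma omega_one_lt_irrelevant (x y : nat + unit) (p q : omega_one_lt x y) :
  p = q.
Proof.
destruct x, y; simpl in p, q; try contradiction.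
- apply le_unique.
- destruct p, q; reflexivity.
Qed.

Lemma omega_one_lt_trans (x y z : nat + unit) :
  omega_one_lt x y -> omega_one_lt y z -> omega_one_lt x z.
Proof. destruct x, y, z; simpl; try tauto; apply Nat.lt_trans. Qed.

Lemma omega_one_lt_ext (x y : nat + unit) :
  (forall u, omega_one_lt u x <-> omega_one_lt u y) -> x = y.
Proof.
destruct x as [m | []], y as [n | []]; intro h; try reflexivity.
- f_equal; destruct (Nat.lt_trichotomy m n) as [l | [e | l]]; [| exact e |].
  + destruct (Nat.lt_irrefl m (proj2 (h (inl m)) l)).
  + destruct (Nat.lt_irrefl n (proj1 (h (inl n)) l)).
- destruct (Nat.lt_irrefl m (proj2 (h (inl m)) I)).
- destruct (Nat.lt_irrefl n (proj1 (h (inl n)) I)).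
Qed.

Lemma omega_one_lt_wf : well_founded omega_one_lt.
Proof.
assert (h : forall n, Acc omega_one_lt (inl n)).
{ intro n; induction (lt_wf n) as [n _ IH]; constructor.
  intros [m | y] hm; [exact (IH m hm) | destruct hm]. }
intros [n | x]; [exact (h n) | constructor].
intros [n | y] hy; [exact (h n) | destruct hy].
Qed.

Lemma omega_one_top_max (y : nat + unit) : ~ omega_one_lt (inr tt) y.
Proof. destruct y; intros []. Qed.

Definition ordinal_omega_one : topped_ordinal :=
  @ToppedOrdinal
    (Ordinal omega_one_lt_irrelevant omega_one_lt_trans omega_one_lt_ext
       omega_one_lt_wf)
    (inr tt) omega_one_top_max.

Definition ordinal_plus (tau upsilon : topped_ordinal) : topped_ordinal :=
  ordinal_sum ordinal_two
    (fun b => match b with inl _ => tau | inr _ => upsilon end).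

Definition ordinal_times (tau upsilon : topped_ordinal) : topped_ordinal :=
  ordinal_sum tau (fun _ => upsilon).

(* Rocq has no induction-recursion.  The pair (E, Delta) is encoded in the
   standard way: the graph of Delta is the inductive family [code], with
   [code o] the type of codes for exactly [o], and [E] is its total space, with
   Delta the first projection.  Primitive projections make all the defining
   equations of Delta, and the computation rules of the induction principle
   [E_ind_rec] below, hold by conversion. *)
Inductive code : topped_ordinal -> Type :=
| code_one : code ordinal_one
| code_omega_one : code ordinal_omega_one
| code_plus : forall o0 o1, code o0 -> code o1 -> code (ordinal_plus o0 o1)
| code_times : forall o0 o1, code o0 -> code o1 -> code (ordinal_times o0 o1)
| code_sum : forall (o : topped_ordinal) (B : o -> topped_ordinal),
    code o -> (forall x : o, code (B x)) -> code (ordinal_sum o B).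

Set Primitive Projections.
Record E : Type := MkE { Delta : topped_ordinal; code_of : code Delta }.
Unset Primitive Projections.

Definition E_one : E := MkE code_one.
Definition E_omega_one : E := MkE code_omega_one.
Definition E_plus (nu0 nu1 : E) : E :=
  MkE (code_plus (code_of nu0) (code_of nu1)).
Definition E_times (nu0 nu1 : E) : E :=
  MkE (code_times (code_of nu0) (code_of nu1)).
Definition E_sum (nu : E) (A : Delta nu -> E) : E :=
  MkE (code_sum (B := fun x => Delta (A x)) (code_of nu)
         (fun x => code_of (A x))).
Arguments E_sum nu A : clear implicits.

Section Induction.

Variables (P : E -> Type)
  (P_one : P E_one)
  (P_omega_one : P E_omega_one)
  (P_plus : forall nu0 nu1, P nu0 -> P nu1 -> P (E_plus nu0 nu1))
  (P_times : forall nu0 nu1, P nu0 -> P nu1 -> P (E_times nu0 nu1))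
  (P_sum : forall (nu : E) (A : Delta nu -> E),
     P nu -> (forall x, P (A x)) -> P (E_sum nu A)).

Fixpoint code_ind_rec (o : topped_ordinal) (c : code o) : P (MkE c) :=
  match c as c in code o return P (MkE c) with
  | code_one => P_one
  | code_omega_one => P_omega_one
  | code_plus c0 c1 => P_plus (code_ind_rec c0) (code_ind_rec c1)
  | code_times c0 c1 => P_times (code_ind_rec c0) (code_ind_rec c1)
  | code_sum c A =>
      P_sum (nu := MkE c) (A := fun x => MkE (A x)) (code_ind_rec c)
        (fun x => code_ind_rec (A x))
  end.

Definition E_ind_rec (nu : E) : P nu := code_ind_rec (code_of nu).

End Induction.

Example Delta_one : Delta E_one = ordinal_one.
Proof. reflexivity. Qed.

Example Delta_omega_one : Delta E_omega_one = ordinal_omega_one.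
Proof. reflexivity. Qed.

Example Delta_plus (nu0 nu1 : E) :
  Delta (E_plus nu0 nu1) = ordinal_plus (Delta nu0) (Delta nu1).
Proof. reflexivity. Qed.

Example Delta_times (nu0 nu1 : E) :
  Delta (E_times nu0 nu1) = ordinal_sum (Delta nu0) (fun _ => Delta nu1).
Proof. reflexivity. Qed.

Example Delta_sum (nu : E) (A : Delta nu -> E) :
  Delta (E_sum nu A) = ordinal_sum (Delta nu) (fun x => Delta (A x)).
Proof. reflexivity. Qed.

(* The three notions below are data, not mere existence or [Prop]-valued
   disjunction.  The alternatives in the last two are mutually exclusive
   propositions, so no truncation is involved. *)
Definition is_retract_of (Y X : Type) : Type :=
  {r : X -> Y & {s : Y -> X | forall y : Y, r (s y) = y}}.

Definition discrete (X : Type) : Type := forall x y : X, {x = y} + {x <> y}.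

Definition trichotomous (o : ordinal) : Type :=
  forall x y : o, {x ≺ y} + {x = y} + {y ≺ x}.

(* Main.v *)
From Stdlib Require Import Arith Cantor.
Require Import Defs.

(** Both being a retract of [nat] and being trichotomous are structure on an
    ordinal that passes from an index ordinal and all its fibres to the
    lexicographic sum, and every constructor of [E] other than the two base
    codes denotes such a sum.  The retraction on a sum comes from the Cantor
    pairing [nat * nat -> nat] ([retract_nat_sigT]).  Comparing two pairs means
    comparing the indices, and the fibre components if the indices agree
    ([ordinal_sum_trichotomous]).  So a point can be coded and two points
    compared by induction on codes, with no appeal to excluded middle or
    choice: retractions and comparisons are data, so a family of them indexed
    by the points of an ordinal is already a function.

    Discreteness follows from the retraction, because a section is injective
    and so reduces equality to equality of natural numbers. *)

Lemma retract_discrete (X Y : Type) :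
  is_retract_of Y X -> discrete X -> discrete Y.
Proof.
intros [r [s rs]] dec x y; destruct (dec (s x) (s y)) as [e | n].
- left; rewrite <- (rs x), <- (rs y), e; reflexivity.
- right; intro e; apply n; rewrite e; reflexivity.
Defined.

(** A pair is coded by the code of its index together with a code of its second
    component relative to the retraction of that fibre.  Decoding must first
    decode the index in order to know which fibre to use. *)
Lemma retract_nat_sigT (X : Type) (Y : X -> Type) :
  is_retract_of X nat -> (forall x, is_retract_of (Y x) nat) ->
  is_retract_of {x : X & Y x} nat.
Proof.
intros [r [s rs]] R.
exists (fun n => let (i, j) := of_nat n in
                 existT Y (r i) (projT1 (R (r i)) j)).
exists (fun u => to_nat (s (projT1 u), proj1_sig (projT2 (R (projT1 u)))
                                         (projT2 u))).
intros [x y]; cbn [projT1 projT2]; rewrite cancel_of_to.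
(* The fibre used for decoding lies over [r (s x)], which equals [x] only
   propositionally: generalizing it to a variable endpoint of the equation
   lets the equation be eliminated, so no transport has to be computed. *)
generalize (rs x); generalize (r (s x)); intros x' e; destruct e.
f_equal; exact (proj2_sig (projT2 (R x')) y).
Defined.

Lemma retract_nat_unit : is_retract_of unit nat.
Proof. exists (fun _ => tt), (fun _ => 0); intros []; reflexivity. Defined.

Lemma retract_nat_two : is_retract_of (unit + unit) nat.
Proof.
exists (fun n => match n with 0 => inl tt | S _ => inr tt end).
exists (fun x => match x with inl _ => 0 | inr _ => 1 end).
intros [[] | []]; reflexivity.
Defined.

Lemma retract_nat_omega_one : is_retract_of (nat + unit) nat.
Proof.
exists (fun n => match n with 0 => inr tt | S m => inl m end).
exists (fun x => match x with inl m => S m | inr _ => 0 end).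
intros [m | []]; reflexivity.
Defined.

Lemma ordinal_one_trichotomous : trichotomous ordinal_one.
Proof. intros [] []; left; right; reflexivity. Defined.

Lemma ordinal_two_trichotomous : trichotomous ordinal_two.
Proof.
intros [[] | []] [[] | []].
- left; right; reflexivity.
- left; left; exact I.
- right; exact I.
- left; right; reflexivity.
Defined.

Lemma ordinal_omega_one_trichotomous : trichotomous ordinal_omega_one.
Proof.
intros [m | []] [n | []].
- destruct (lt_eq_lt_dec m n) as [[l | e] | g].
  + left; left; exact l.
  + left; right; rewrite e; reflexivity.
  + right; exact g.
- left; left; exact I.
- right; exact I.
- left; right; reflexivity.
Defined.

(** The trichotomy of the index yields either a strict comparison, which decides
    the lexicographic order, or an identification of the two indices, along
    which both second components come to lie in one fibre. *)
Lemma ordinal_sum_trichotomous (tau : topped_ordinal)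
    (upsilon : tau -> topped_ordinal) :
  trichotomous tau -> (forall x, trichotomous (upsilon x)) ->
  trichotomous (ordinal_sum tau upsilon).
Proof.
intros T U [x a] [y b]; destruct (T x y) as [[l | e] | g].
- left; left; left; exact l.
- destruct e; destruct (U x a b) as [[l | e] | g].
  + left; left; right; exists eq_refl; exact l.
  + left; right; rewrite e; reflexivity.
  + right; right; exists eq_refl; exact g.
- right; left; exact g.
Defined.

Lemma ordinal_sum_retract_trichotomous (tau : topped_ordinal)
    (upsilon : tau -> topped_ordinal) :
  is_retract_of tau nat * trichotomous tau ->
  (forall x, is_retract_of (upsilon x) nat * trichotomous (upsilon x)) ->
  is_retract_of (ordinal_sum tau upsilon) nat *
  trichotomous (ordinal_sum tau upsilon).
Proof.
intros [R T] H; split.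
- exact (retract_nat_sigT _ (fun x => upsilon x) R (fun x => fst (H x))).
- exact (ordinal_sum_trichotomous _ _ T (fun x => snd (H x))).
Defined.

Lemma Delta_retract_trichotomous (nu : E) :
  is_retract_of (Delta nu) nat * trichotomous (Delta nu).
Proof.
revert nu; apply E_ind_rec.
- split; [exact retract_nat_unit | exact ordinal_one_trichotomous].
- split; [exact retract_nat_omega_one | exact ordinal_omega_one_trichotomous].
- intros nu0 nu1 H0 H1; apply ordinal_sum_retract_trichotomous.
  + split; [exact retract_nat_two | exact ordinal_two_trichotomous].
  + intros [x | x]; [exact H0 | exact H1].
- intros nu0 nu1 H0 H1.
  exact (ordinal_sum_retract_trichotomous _ _ H0 (fun _ => H1)).
- intros nu A H HA.
  exact (ordinal_sum_retract_trichotomous _ (fun x => Delta (A x)) H HA).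
Defined.

Theorem theorem7p2 (nu : E) :
  is_retract_of (Delta nu) nat * discrete (Delta nu) * trichotomous (Delta nu).
Proof.
destruct (Delta_retract_trichotomous nu) as [R T].
exact (R, retract_discrete _ _ R Nat.eq_dec, T).
Qed.
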